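(* Let $\mathcal{N}=(Q,Act,\delta)$ be a one-counter net and let $(p,q)\in Q\times Q$ be such that the frontier function $f_{\langle p,q\rangle}$ satisfies: $f_{\langle p,q\rangle}(n)\neq\infty$ for all $n\in\mathbb{N}$, and there is no $c\in\mathbb{N}$ with $f_{\langle p,q\rangle}(n)<c$ for all $n\in\mathbb{N}$. Then there are $\alpha\in\mathbb{Q}_+$ (a positive rational) and $c\in\mathbb{N}$ such that $|f_{\langle p,q\rangle}(n)-\alpha\cdot n|\leq c$ for all $n\in\mathbb{N}$.
   Context: A one-counter net is $\mathcal{N}=(Q,Act,\delta)$ with finite $Q$, $Act$ and rules $\delta\subseteq Q\times Act\times\{-1,0,1\}\times Q$; its LTS has states $q(m)\in Q\times\mathbb{N}$ with $q(m)\xrightarrow{a}q'(n)$ iff $(q,a,n-m,q')\in\delta$. $\preceq$ is simulation preorder on this LTS (union of all simulations). For $(p,q)\in Q\times Q$ the frontier function $f_{\langle p,q\rangle}:\mathbb{N}\to\mathbb{N}\cup\{-1,\infty\}$ is: $f_{\langle p,q\rangle}(n)=\infty$ if $p(m)\preceq q(n)$ for all $m\in\mathbb{N}$; $f_{\langle p,q\rangle}(n)=-1$ if $p(0)\not\preceq q(n)$; and $f_{\langle p,q\rangle}(n)=\max\{m\in\mathbb{N}\mid p(m)\preceq q(n)\}$ otherwise. *)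

(* Defs.v *)
From HB Require Import structures.
From mathcomp Require Import all_boot all_order all_algebra.
From mathcomp Require Import boolp classical_sets constructive_ereal.

Set Implicit Arguments.
Unset Strict Implicit.
Unset Printing Implicit Defensive.

Import Order.TTheory GRing.Theory Num.Theory.

Local Open Scope ring_scope.

Record ocn : Type := OCN {
  state : finType;
  act : finType;
  rules : pred (state * act * int * state);
  rules_effect : forall p a d q,
    rules (p, a, d, q) -> d \in [:: -1; 0; 1]
}.

Definition config (N : ocn) : Type := (state N * nat)%type.

Definition step (N : ocn) (s : config N) (a : act N) (t : config N) : Prop :=
  rules (s.1, a, t.2%:Z - s.2%:Z, t.1).

Definition simulation (N : ocn) (R : config N -> config N -> Prop) : Prop :=
  forall s t, R s t -> forall a s', step s a s' ->
    exists2 t', step t a t' & R s' t'.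

Definition simulated (N : ocn) (s t : config N) : Prop :=
  exists2 R : config N -> config N -> Prop, simulation R & R s t.

Definition simulated_counters (N : ocn) (p q : state N) (n : nat) : set nat :=
  [set m | simulated (p, m) (q, n)]%classic.

(* The default value 0 of [xget] is never used, see [frontier_maxP]. *)
Definition frontier (N : ocn) (p q : state N) (n : nat) : \bar rat :=
  let A := simulated_counters p q n in
  if `[< forall m, A m >] then +oo%E
  else if `[< ~ A 0%N >] then (-1)%:E
  else (xget 0%N (A `&` ubound A)%classic)%:R%:E.

Lemma simulatedW (N : ocn) (p : state N) (m k : nat) (t : config N) :
  (k <= m)%N -> simulated (p, m) t -> simulated (p, k) t.
Proof.
move=> lekm [R simR Rmt].
pose R' (s u : config N) := exists d, R (s.1, (s.2 + d)%N) u.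
exists R'; last by exists (m - k)%N; rewrite /= subnKC.
move=> s u [d Rsu] a s' ss'.
have ss'd : step (s.1, (s.2 + d)%N) a (s'.1, (s'.2 + d)%N).
  by move: ss'; rewrite /step /= !PoszD opprD addrACA subrr addr0.
by have [u' uu' Ru'] := simR _ _ Rsu _ _ ss'd; exists u' => //; exists d.
Qed.

Lemma frontier_maxP (N : ocn) (p q : state N) (n : nat) :
  let A := simulated_counters p q n in
  ~ (forall m, A m) -> A 0%N ->
  exists2 m, frontier p q n = m%:R%:E & A m /\ forall k, A k -> (k <= m)%N.
Proof.
move=> A nA A0; exists (xget 0%N (A `&` ubound A)%classic).
  rewrite /frontier -/A; case: asboolP => // _.
  by case: asboolP => //; case/(_ A0).
have /existsNP [b nAb] := nA.
have ubA k : A k -> (k <= b)%N.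
  by move=> Ak; rewrite leqNgt; apply/negP => /ltnW /simulatedW /(_ Ak).
have exA : exists k, `[< A k >] by exists 0%N; apply/asboolP.
have ubA' k : `[< A k >] -> (k <= b)%N by move/asboolP/ubA.
case: (ex_maxnP exA ubA') => m /asboolP Am maxm.
have : (A `&` ubound A)%classic m.
  by split=> // k /asboolP Ak; rewrite leEnat; exact: maxm.
by case/(xgetI 0%N) => [? ub]; split=> // k /ub.
Qed.

(* Main.v *)
(* Colour the point (x, y) of the plane of (p, q) black if p(y) is simulated by
   q(x), white otherwise.  The engine is a travelling argument: if (x, y) is white
   and its translate by a vector v is black in the same plane, then copying the
   winning attack at the white point and the sound defence at the black one gives
   a neighbouring pair of this kind, in some plane, and this ends only at an axis.
   A vector that is nowhere violated in some column is thus not violated to the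
   right of it, and a vector v by which all frontiers of a group, well separated
   from the others, move in two columns is a period of the group in between.

   Consider a set J of planes lying ever further below all other unbounded finite
   frontiers.  Splitting J into clusters that are far from each other but of
   bounded width, and applying the pigeonhole principle to the shapes of the
   clusters, one finds long stretches where all clusters are periodic with a
   common small period a; let b be the rise of the fastest one.  By travelling,
   eventually no frontier in J rises by more than b in a steps, and in one fixed
   column, for each l, some frontier in J rises by l b in l a steps, so that a
   single frontier of J does so for all l.  The frontiers of J at bounded distance
   from the line of slope b / a lie in belts, all others of J fall infinitely far
   behind them, and one concludes by induction on J. *)

Require Import Defs.
From mathcomp Require Import all_boot all_order all_algebra.
From mathcomp Require Import boolp constructive_ereal.
From mathcomp Require Import zify ring lra.

Import Order.TTheory GRing.Theory Num.Theory.

Set Implicit Arguments.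
Unset Strict Implicit.
Unset Printing Implicit Defensive.

Local Open Scope nat_scope.

(** * Finite choices and pigeonholes *)

Lemma eventually_forall (T : finType) (P : T -> nat -> Prop) :
  (forall t, exists N, forall n, N <= n -> P t n) ->
  exists N, forall n, N <= n -> forall t, P t n.
Proof.
move=> /choice [f Pf]; exists (\max_t f t) => n le_n t; apply: Pf.
exact: leq_trans (leq_bigmax t) le_n.
Qed.

Lemma pigeonhole (T : finType) (f : nat -> T) :
  exists u v, [/\ u < v, v <= #|T| & f u = f v].
Proof.
have /injectivePn [u [v neq_uv eqf]] : ~~ injectiveb (fun u : 'I_#|T|.+1 => f u).
  by apply/injectiveP => /leq_card; rewrite card_ord ltnn.
wlog lt_uv : u v neq_uv eqf / u < v => [IH|].
  have [/IH|/IH|/val_inj eq_uv] := ltngtP u v; first exact.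
    by rewrite eq_sym; apply.
  by rewrite eq_uv eqxx in neq_uv.
by exists u, v; split=> //; rewrite -ltnS.
Qed.

Definition adjacent (x x' : nat) := x <= x'.+1 /\ x' <= x.+1.

(** * Colourings whose violations travel *)

Section Colouring.

Variables (K : finType) (black : K -> nat -> nat -> Prop).

Hypothesis black_mono : forall k x x' y y',
  x <= x' -> y' <= y -> black k x y -> black k x' y'.

(* Two offsets instead of one vector, so that vectors of both signs are covered
   without leaving nat: (0, 0), (a, b) for the vector (a, b) and the reverse for
   its opposite. *)
Definition violation a1 b1 a2 b2 k x y :=
  black k (x + a2) (y + b2) /\ ~ black k (x + a1) (y + b1).

Hypothesis violation_travels :
  forall a1 b1 a2 b2 (V : K -> nat -> nat -> Prop),
  (forall k x y, V k x y -> violation a1 b1 a2 b2 k x y ->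
     [/\ 0 < x, 0 < y &
       forall k' x' y', adjacent x x' -> adjacent y y' ->
         violation a1 b1 a2 b2 k' x' y' -> V k' x' y']) ->
  forall k x y, V k x y -> ~ violation a1 b1 a2 b2 k x y.

Definition steep k := (forall x, exists y, ~ black k x y) /\
  (forall y, exists x, black k x y).

Definition steep_pairs : {set K} := [set k | `[< steep k >]].

(* The number of black points in column x, that is, the frontier value plus one. *)
Definition height k x : nat :=
  if pselect (exists y, `[< ~ black k x y >]) is left exy then ex_minn exy else 0.
Local Notation h := height.

Lemma heightP k x y : k \in steep_pairs -> black k x y <-> y < h k x.
Proof.
rewrite inE => /asboolP [+ _] => /(_ x) [z nz].
rewrite /height; case: pselect => [exy|[]]; last by exists z; apply/asboolP.
case: ex_minnP => m /asboolP nm minm; split=> [bw|lt_ym].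
  by rewrite ltnNge; apply/negP => le_my; apply: nm; apply: black_mono bw.
by apply: contrapT => /asboolP /minm; rewrite leqNgt lt_ym.
Qed.

Lemma height_mono k x x' : k \in steep_pairs -> x <= x' -> h k x <= h k x'.
Proof.
move=> kS le_x; rewrite leqNgt; apply/negP => lt_h.
have /heightP-/(_ kS)/(black_mono le_x (leqnn _)) := lt_h.
by move/heightP => /(_ kS); rewrite ltnn.
Qed.

Lemma height_unbounded c :
  exists N, forall x, N <= x -> forall k, k \in steep_pairs -> c <= h k x.
Proof.
apply: eventually_forall => k.
have [kS|kNS] := boolP (k \in steep_pairs); last by exists 0.
have := kS; rewrite inE => /asboolP [_ /(_ c) [N bN]].
exists N => x le_x _; apply/ltnW/heightP => //; exact: black_mono bN.
Qed.

(** A plane that is not steep has a black column or a white row; by monotonicity all columns to the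
    right of it are black, or all rows above it white. *)
Lemma colour_trichotomy : exists c, forall k, [\/ k \in steep_pairs,
  forall x y, c <= x -> black k x y | forall x y, c <= y -> ~ black k x y].
Proof.
suff [N NP] : exists N, forall n, N <= n -> forall k, [\/ k \in steep_pairs,
  forall x y, n <= x -> black k x y | forall x y, n <= y -> ~ black k x y].
  by exists N; apply: NP.
apply: eventually_forall => k.
have [fin|/existsNP [x0 b0]] := EM (forall x, exists y, ~ black k x y); last first.
  exists x0 => n le_n; constructor 2 => x y le_x; apply: contrapT => nb; apply: b0.
  by exists y => b; apply: nb; apply: black_mono b => //; lia.
have [unb|/existsNP [y0 b0]] := EM (forall y, exists x, black k x y).
  by exists 0 => n _; constructor 1; rewrite inE; apply/asboolP.
exists y0 => n le_n; constructor 3 => x y le_y b; apply: b0.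
by exists x; apply: black_mono b => //; lia.
Qed.

(** The vector (1, C) is not violated in column N, as C is at least every height in column N + 1,
    nor in monochrome planes from there on. So a violation further right would travel without ever
    meeting an axis. *)
Lemma height_lipschitz : exists C, forall k x, k \in steep_pairs -> h k x.+1 <= h k x + C.
Proof.
have [c cP] := colour_trichotomy.
have [N0 N0P] := height_unbounded 1.
pose N := c + N0; pose C := c + \max_k h k N.+1.
have leC k : h k N.+1 <= C by rewrite /C; have := leq_bigmax (F := fun k => h k N.+1) k; lia.
exists C => k x kS; have [lt_x|le_x] := leqP x N.
  by have := height_mono kS (lt_x : x.+1 <= N.+1); have := leC k; lia.
rewrite leqNgt; apply/negP => /heightP-/(_ kS); rewrite -[x.+1]addn1 => b.
have := @violation_travels 0 0 1 C (fun k x y => k \in steep_pairs /\ N < x) _ k x (h k x).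
case=> //; last by split=> //; rewrite !addn0 => /heightP-/(_ kS); rewrite ltnn.
move=> {kS le_x b}k {}x y [kS lt_x] [_]; rewrite !addn0 => nb.
have le_hy : h k x <= y by rewrite leqNgt; apply/negP => /heightP-/(_ kS).
have := N0P x _ k kS; split=> [||k' x' y' [xx' x'x] _ []]; [lia..|].
rewrite !addn0 => b' nb'; case: (cP k') => [k'steep_pairs|k'b|k'w].
- split=> //; rewrite ltn_neqAle; apply/andP; split; last lia.
  apply/eqP => eqN; move: b'; rewrite -eqN addn1 => /heightP-/(_ k'steep_pairs).
  by have := leC k'; lia.
- by case: nb'; apply: k'b; lia.
- by case: (k'w _ _ _ b'); lia.
Qed.


(** * Sets of planes far below the others *)

Section Lower.

Variables (C : nat) (J : {set K}).
Hypothesis lip : forall k x, k \in steep_pairs -> h k x.+1 <= h k x + C.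
Hypothesis JS : J \subset steep_pairs.
Hypothesis gap : forall M, exists N, forall x, N <= x ->
  forall i j, i \in steep_pairs -> i \notin J -> j \in J -> h j x + M <= h i x.

Lemma height_lipschitzn k x n : k \in steep_pairs -> h k (x + n) <= h k x + C * n.
Proof.
move=> kS; elim: n => [|n IHn]; first by rewrite !addn0 muln0 addn0.
by rewrite addnS mulnS; have := lip (x + n) kS; lia.
Qed.

(** Near a frontier of [J] the monochrome planes have no violations, and the other steep frontiers
    run so high that the white point of a violation would lie below them. *)
Lemma violation_stays W : exists N, forall x k y, N <= x -> k \in J ->
  y <= h k x + W -> h k x <= y + W ->
  [/\ 0 < x, 0 < y & forall a1 b1 a2 b2 k' x' y', b1 <= W ->
    adjacent x x' -> adjacent y y' ->
    violation a1 b1 a2 b2 k' x' y' -> k' \in J].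
Proof.
have [c cP] := colour_trichotomy.
have [N0 N0P] := height_unbounded (c + W + 2).
have [N1 N1P] := gap (2 * W + C + 2).
exists (c + N0 + N1).+1 => x k y le_x kJ ley lhy.
have kS := subsetP JS k kJ; have := N0P x ltac:(lia) k kS.
split=> [||a1 b1 a2 b2 k' x' y' leb [xx' x'x] [yy' y'y] [b nb]]; [lia..|].
case: (cP k') => [k'steep_pairs|k'b|k'w]; last 2 first.
- by case: nb; apply: k'b; lia.
- by case: (k'w _ _ _ b); lia.
apply: contraT => k'NJ; case: nb; apply/heightP => //.
have := N1P x' ltac:(lia) _ _ k'steep_pairs k'NJ kJ.
have := height_mono kS xx'; have := lip x' kS.
by have := height_mono k'steep_pairs (leq_addr a1 x'); lia.
Qed.

(** A violation of (a, b) would travel within [J] without crossing column n. The crude bound W keeps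
    it within W of the frontiers, where [violation_stays] applies. *)
Lemma dominated_right W : exists N, forall n a b, N <= n ->
  (forall x j, n <= x -> j \in J -> h j (x + a) <= h j x + b + W) ->
  (forall j, j \in J -> h j (n + a) <= h j n + b) ->
  forall x j, n <= x -> j \in J -> h j (x + a) <= h j x + b.
Proof.
have [N NP] := violation_stays W; exists N => n a b le_n near dom x j le_x jJ.
have [->|neq_x] := eqVneq x n; first exact: dom.
rewrite leqNgt; apply/negP => /heightP-/(_ (subsetP JS j jJ)) bj.
pose V k x (y : nat) := k \in J /\ n < x.
have := @violation_travels 0 0 a b V _ j x (h j x); case; last 2 first.
- by split=> //; lia.
- by split=> //; rewrite !addn0 => /heightP-/(_ (subsetP JS j jJ)); rewrite ltnn.
move=> {jJ neq_x le_x bj} {}j {}x y [jJ lt_x] viol.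
have jS := subsetP JS j jJ; have [/heightP-/(_ jS) bj] := viol; rewrite !addn0 => wj.
have le_hy : h j x <= y by rewrite leqNgt; apply/negP => /heightP-/(_ jS).
have ub := near x j (ltnW lt_x) jJ.
have [|||x0 y0 stay] := NP x j y _ jJ; [lia..|].
split=> // k' x' y' xx' yy' viol'; have k'J := stay _ _ _ _ _ _ _ (leq0n _) xx' yy' viol'.
split=> //; rewrite ltn_neqAle; apply/andP; split; last by case: xx'; lia.
apply/eqP => eqn; case: viol' => /heightP; rewrite (subsetP JS _ k'J) !addn0 -eqn.
move=> /(_ isT) lt_h; apply; apply/heightP; first exact: subsetP JS _ k'J.
by have := dom k' k'J; lia.
Qed.

Lemma periodic_between A : exists N M, forall a y1 y2 (beta : K -> nat),
  a <= A -> N <= y1 ->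
  (forall x i j, y1 <= x <= y2 -> i \in J -> j \in J -> beta i != beta j ->
     h i x + M <= h j x \/ h j x + M <= h i x) ->
  (forall k, k \in J -> h k (y1 + a) = h k y1 + beta k) ->
  (forall k, k \in J -> h k (y2 + a) = h k y2 + beta k) ->
  forall x k, y1 <= x <= y2 -> k \in J -> h k (x + a) = h k x + beta k.
Proof.
have [N NP] := violation_stays (C * A).
exists N, (2 * (C * A) + C + 2) => a y1 y2 beta le_a le_y1 sep per1 per2 x k x12 kJ.
have lea : C * a <= C * A by rewrite leq_mul2l le_a orbT.
have lebeta j : j \in J -> beta j <= C * A.
  by move=> jJ; have := per1 j jJ; have := height_lipschitzn y1 a (subsetP JS j jJ); lia.
have near b a1 b1 a2 b2 j z y : b <= C * A -> j \in J ->
    (a1, b1, a2, b2) \in [:: (0, 0, a, b); (a, b, 0, 0)] ->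
    violation a1 b1 a2 b2 j z y -> y <= h j z + C * A /\ h j z <= y + C * A.
  move=> leb jJ; have jS := subsetP JS j jJ.
  have := height_lipschitzn z a jS; have := height_mono jS (leq_addr a z).
  rewrite !inE => le1 le2 /orP[]/eqP[-> -> -> ->] []; rewrite !addn0 !heightP //; lia.
have match_col b a1 b1 a2 b2 j z y : j \in J ->
    (a1, b1, a2, b2) \in [:: (0, 0, a, b); (a, b, 0, 0)] ->
    h j (z + a) = h j z + b -> ~ violation a1 b1 a2 b2 j z y.
  move=> jJ; have jS := subsetP JS j jJ.
  rewrite !inE => /orP[]/eqP[-> -> -> ->] eqh []; rewrite !addn0 !heightP //; lia.
suff noviol b a1 b1 a2 b2 y :
    beta k = b -> (a1, b1, a2, b2) \in [:: (0, 0, a, b); (a, b, 0, 0)] ->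
    ~ violation a1 b1 a2 b2 k x y.
  have kS := subsetP JS k kJ; apply/eqP; rewrite eqn_leq; apply/andP; split.
    rewrite leqNgt; apply/negP => lt_h; apply: (noviol (beta k) 0 0 a (beta k) (h k x)) => //.
      by rewrite !inE eqxx //.
    by split; rewrite ?addn0 heightP // ltnn.
  have [|||_ h_gt0 _] := NP x k (h k x) _ kJ; [lia..|].
  rewrite leqNgt; apply/negP => lt_h.
  (* If the rise is too small, the translate of the topmost black point of column x is white, which
     violates the opposite vector. *)
  apply: (noviol (beta k) a (beta k) 0 0 (h k x).-1) => //.
    by rewrite !inE eqxx orbT.
  by split; rewrite ?addn0 heightP //; lia.
move=> betak off; have [[->|->]|neq] := @pselect (x = y1 \/ x = y2).
- by apply: (match_col b) => //; rewrite -betak per1.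
- by apply: (match_col b) => //; rewrite -betak per2.
pose V j z (w : nat) := [/\ j \in J, beta j = b & y1 < z < y2].
have leb : b <= C * A by rewrite -betak lebeta.
apply: (violation_travels (V := V)) => [{neq x12 betak kJ}{}k {}x {}y [kJ betak x12] viol|].
  have [le1 le2] := near _ _ _ _ _ _ _ _ leb kJ off viol.
  have [|||x0 y0 stay] := NP x k y _ kJ; [lia..|].
  split=> // k' x' y' [xx1 xx2] [yy1 yy2] viol'.
  have leb1 : b1 <= C * A by move: off; rewrite !inE => /orP[]/eqP[_ -> _ _].
  have k'J := stay _ _ _ _ _ _ _ leb1 (conj xx1 xx2) (conj yy1 yy2) viol'.
  have [le1' le2'] := near _ _ _ _ _ _ _ _ leb k'J off viol'.
  have betak' : beta k' = b.
    apply/eqP/negPn/negP => neqb.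
    have k'steep_pairs := subsetP JS k' k'J.
    have := height_mono k'steep_pairs xx1; have := height_mono k'steep_pairs xx2.
    have := lip x k'steep_pairs; have := lip x' k'steep_pairs.
    have {x12}x12 : y1 <= x <= y2 by lia.
    by have := sep x k' k x12 k'J kJ; rewrite betak => /(_ neqb); lia.
  split=> //.
  have ney1 : x' <> y1.
    move=> eqx; apply: (match_col b _ _ _ _ _ _ _ k'J off _ viol').
    by rewrite eqx -betak' per1.
  have ney2 : x' <> y2.
    move=> eqx; apply: (match_col b _ _ _ _ _ _ _ k'J off _ viol').
    by rewrite eqx -betak' per2.
  lia.
split=> //; lia.
Qed.

(** * Clusters and long periodic stretches *)

Definition separated (A : {set K * K}) M x := forall i j, i \in J -> j \in J ->
  (i, j) \notin A -> h i x + M <= h j x \/ h j x + M <= h i x.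

Lemma separatedW A M M' x : M' <= M -> separated A M x -> separated A M' x.
Proof. by move=> leM sep i j iJ jJ /sep-/(_ iJ jJ); lia. Qed.

Lemma separated_later A M n x : separated A (M + C * n) x -> separated A M (x + n).
Proof.
move=> sep i j iJ jJ /sep-/(_ iJ jJ).
have iS := subsetP JS i iJ; have jS := subsetP JS j jJ.
have := height_lipschitzn x n iS; have := height_lipschitzn x n jS.
have := height_mono iS (leq_addr n x); have := height_mono jS (leq_addr n x); lia.
Qed.

(* Choosing A minimal, among the relations with arbitrarily well separated columns,
   is what bounds the width of the clusters. *)
Lemma exists_clusters : exists A G,
  (forall M n, exists2 x, n <= x & separated A M x) /\
  (forall x i j, G <= x -> separated A G x -> i \in J -> j \in J -> (i, j) \in A ->
     h i x <= h j x + G /\ h j x <= h i x + G).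
Proof.
pose P A := `[< forall M n, exists2 x, n <= x & separated A M x >].
have PT : P setT by apply/asboolP => M n; exists n => // i j _ _; rewrite inE.
have [A /minsetP [/asboolP PA minA]] := ex_minset (ex_intro (fun A => P A) _ PT).
(* By minimality, dropping any pair p from A destroys the separation far to the right; one G serves
   all p. *)
have [G GP] : exists G, forall n, G <= n -> forall p, p \in A ->
    forall x, n <= x -> ~ separated (A :\ p) n x.
  apply: eventually_forall => p; have [pA|] := boolP (p \in A); last by exists 0.
  have : ~ forall M n, exists2 x, n <= x & separated (A :\ p) M x.
    move=> /asboolP PAp; have /setP/(_ p) := minA _ PAp (subD1set A p).
    by rewrite !inE eqxx pA.
  move=> /existsNP [M /existsNP [n nP]]; exists (M + n) => m le_m _ x le_x sep.
  by apply: nP; exists x; [lia | apply: separatedW sep; lia].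
exists A, G; split=> // x i j le_x sep iJ jJ ijA; apply: contrapT => far.
apply: (GP G (leqnn G) _ ijA x le_x) => i' j' i'J j'J.
rewrite !inE negb_and negbK => /orP[/eqP[-> ->]|]; [lia | exact: sep].
Qed.

(** Inside clusters the height differences are bounded, so their pattern repeats within P steps, and
    then all planes of a cluster rise equally. Among enough windows two agree in the period and all
    rises, and [periodic_between] fills the stretch between them. *)
Lemma long_periods j0 : j0 \in J -> exists P B, forall L n, exists y a b,
  [/\ n <= y, 0 < a <= P, b <= B,
      forall j, j \in J -> h j (y + a) <= h j y + b
    & exists2 j, j \in J & forall l, l <= L -> h j (y + l * a) = h j y + l * b].
Proof.
move=> j0J; have [A [G [sepA tightA]]] := exists_clusters.
(* The offset G makes the subtraction exact for pairs of A, with values up to 2 G; other pairs are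
   never read. *)
pose pat z := [ffun p : K * K => inord (h p.1 z + G - h p.2 z) : 'I_(2 * G).+1].
pose P := #|{ffun K * K -> 'I_(2 * G).+1}|; pose B := C * P.
have [N [M perNM]] := periodic_between P.
exists P, B => L n.
pose Theta := #|{: 'I_P.+1 * {ffun K -> 'I_B.+1}}|.
(* Windows start s columns apart and repeat their pattern within their first P columns, which leaves
   room for L steps of length at most P. *)
pose s := (L.+1 * P).+1; pose T := Theta.+1 * s + P.
have [x le_x sepx] := sepA (G + M + C * T) (n + G + N).
have sepxt z : x <= z <= x + T -> separated A (G + M) z.
  move=> /andP[le1 le2]; rewrite -(subnKC le1); apply: separated_later.
  apply: separatedW sepx; rewrite leq_add2l leq_mul2l; lia.
have tight z i j : x <= z <= x + T -> i \in J -> j \in J -> (i, j) \in A ->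
    h i z <= h j z + G /\ h j z <= h i z + G.
  move=> zx; apply: tightA; first lia.
  by apply: separatedW (sepxt _ zx); lia.
have pat_eq z z' i j : x <= z <= x + T -> x <= z' <= x + T -> pat z = pat z' ->
    i \in J -> j \in J -> (i, j) \in A -> h i z + h j z' = h i z' + h j z.
  move=> zx z'x /ffunP/(_ (i, j)); rewrite !ffunE /= => /(congr1 val) /=.
  move=> eqv iJ jJ ijA; have [? ?] := tight z i j zx iJ jJ ijA.
  have [? ?] := tight z' i j z'x iJ jJ ijA.
  by move: eqv; rewrite !inordK; lia.
have /choice [r rP] : forall u, exists ya : nat * nat,
    [/\ x + u * s <= ya.1, ya.1 + ya.2 <= x + u * s + P, 0 < ya.2
       & pat ya.1 = pat (ya.1 + ya.2)].
  move=> u; have [v [w [lt_vw lew eqp]]] := pigeonhole (fun i => pat (x + u * s + i)).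
  exists (x + u * s + v, w - v) => /=; split; [lia|rewrite -/P in lew; lia|lia|].
  have -> : x + u * s + v + (w - v) = x + u * s + w by lia.
  exact: eqp.
pose typ u : 'I_P.+1 * {ffun K -> 'I_B.+1} :=
  (inord (r u).2, [ffun k => inord (h k ((r u).1 + (r u).2) - h k (r u).1)]).
have [u [v [lt_uv lev [eqa /ffunP eqb]]]] := pigeonhole typ.
case: (r u) (r v) (rP u) (rP v) eqa eqb => [y1 a1] [y2 a] /=.
move=> [ly1 ly1' a1_gt0 pat1] [ly2 ly2' a_gt0 pat2] /(congr1 val) eqa eqb.
have {eqa} eqa : a1 = a by move: eqa => /=; rewrite !inordK; lia.
rewrite {a1}eqa in ly1' a1_gt0 pat1 eqb *.
have us_vs : u * s + s <= v * s by rewrite -mulSnr leq_mul2r lt_uv orbT.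
have vs_T : v * s + P <= T by rewrite leq_add2r leq_mul2r ltnW ?orbT // ltnS.
have leB k y : k \in J -> h k (y + a) - h k y < B.+1.
  move=> kJ; have := height_lipschitzn y a (subsetP JS k kJ).
  have : C * a <= B by rewrite leq_mul2l; lia.
  lia.
pose beta k := h k (y1 + a) - h k y1.
have betaE1 k : k \in J -> h k (y1 + a) = h k y1 + beta k.
  by move=> kJ; rewrite subnKC // height_mono ?(subsetP JS) ?leq_addr.
have betaE2 k : k \in J -> h k (y2 + a) = h k y2 + beta k.
  move=> kJ; have /(congr1 val) := eqb k; rewrite !ffunE /= !inordK ?leB // /beta => ->.
  by rewrite subnKC // height_mono ?(subsetP JS) ?leq_addr.
have per := perNM a y1 y2 beta ltac:(lia) ltac:(lia) _ betaE1 betaE2.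
have {}per z k : y1 <= z <= y2 -> k \in J -> h k (z + a) = h k z + beta k.
  apply: per => {z k} z i j z12 iJ jJ neq_beta.
  apply: (separatedW (leq_addl G M) (sepxt z _) iJ jJ); first lia.
  apply: contraNN neq_beta => ijA; have := betaE1 i iJ; have := betaE1 j jJ.
  have := pat_eq y1 (y1 + a) i j ltac:(lia) ltac:(lia) pat1 iJ jJ ijA.
  by move=> e1 e2 e3; apply/eqP; lia.
pose j1 := [arg max_(j > j0 in J) beta j].
have [j1J maxj1] : j1 \in J /\ forall j, j \in J -> beta j <= beta j1.
  by rewrite /j1; case: arg_maxnP.
exists y1, a, (beta j1); split=> [||||]; [lia|lia|by rewrite -ltnS leB| |].
  by move=> j jJ; rewrite betaE1 // leq_add2l maxj1.
exists j1 => // l; elim: l => [|l IHl] leL; first by rewrite !mul0n !addn0.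
have le_laP : l * a <= L * P by apply: leq_mul; lia.
rewrite !mulSnr addnA per //; first by rewrite (IHl (ltnW leL)) addnA.
have sE : s = P + L * P + 1 by rewrite /s mulSn addn1.
lia.
Qed.

Lemma exists_top_speed j0 : j0 \in J -> exists a b N, [/\ 0 < a,
    forall x j, N <= x -> j \in J -> h j (x + a) <= h j x + b
  & forall l n, exists y j, [/\ n <= y, j \in J & h j (y + l * a) = h j y + l * b]].
Proof.
move=> j0J; have [P [B perPB]] := long_periods j0J.
pose Q a b n := exists y, [/\ n <= y, 0 < a,
  forall j, j \in J -> h j (y + a) <= h j y + b
  & exists2 j, j \in J & forall l, l <= n -> h j (y + l * a) = h j y + l * b].
(* The pairs (a, b) range over a finite set, so one of them serves for all n. *)
have [a [b Qab]] : exists a b, forall n, Q a b n.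
  apply: contrapT => nQ.
  have [|N NP] := @eventually_forall ('I_P.+1 * 'I_B.+1)%type (fun t n => ~ Q t.1 t.2 n).
    move=> [a b] /=.
    have /existsNP [n nQn] : ~ forall n, Q a b n by move=> Qab; apply: nQ; exists a, b.
    exists n => m le_m [y [ley a_gt0 dom [j jJ per]]]; apply: nQn.
    exists y; split=> //; first by lia.
    by exists j => // l lel; apply: per; lia.
  have [y [a [b [ley /andP[a_gt0 lea] leb dom per]]]] := perPB N N.
  apply: (NP N (leqnn N) (inord a, inord b)); rewrite /= !inordK //.
  by exists y; split.
have [N NP] := dominated_right (C * a).
have [y [leNy a_gt0 dom _]] := Qab N.
exists a, b, y; split=> // [|l n]; last first.
  have [z [lez _ _ [j jJ per]]] := Qab (l + n).
  by exists z, j; split=> //; [lia | apply: per; lia].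
apply: (NP y a b) => // x j _ jJ.
by have := height_lipschitzn x a (subsetP JS j jJ); lia.
Qed.

Lemma dominated_iter a b N j : j \in J ->
  (forall x j, N <= x -> j \in J -> h j (x + a) <= h j x + b) ->
  forall x l, N <= x -> h j (x + l * a) <= h j x + l * b.
Proof.
move=> jJ dom x l le_x; elim: l => [|l IHl]; first by rewrite !mul0n !addn0.
rewrite !mulSnr !addnA; apply: leq_trans (dom _ _ _ jJ) _; first lia.
by rewrite leq_add2r.
Qed.

(* The bound N1 for the column does not depend on l: knowing that (a, b) is not
   violated to the right keeps every violation of (l a, l b - 1) within distance 1
   of the frontiers, whatever the length of the vector. *)
Lemma exists_top_line j0 : j0 \in J -> exists a b N j, [/\ 0 < a, j \in J,
    forall x j, N <= x -> j \in J -> h j (x + a) <= h j x + b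
  & forall l, h j N + l * b <= h j (N + l * a)].
Proof.
move=> j0J; have [a [b [N0 [a_gt0 dom fast]]]] := exists_top_speed j0J.
have [N1 N1P] := dominated_right 1; pose N := N0 + N1.
have {}dom x j : N <= x -> j \in J -> h j (x + a) <= h j x + b.
  by move=> le_x; apply: dom; lia.
have fastN l : exists2 j, j \in J & h j N + l * b <= h j (N + l * a).
  apply: contrapT => slow.
  have {}slow j : j \in J -> h j (N + l * a) < h j N + l * b.
    by move=> jJ; rewrite ltnNge; apply/negP => lej; apply: slow; exists j.
  have lb_gt0 : 0 < l * b.
    by have := slow _ j0J; have := height_mono (subsetP JS _ j0J) (leq_addr (l * a) N); lia.
  have [y [j [ley jJ eqy]]] := fast l N.
  (* The vector (l a, l b - 1) is not violated in column N, hence not at y, where the rise l b is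
     attained. *)
  suff : h j (y + l * a) <= h j y + (l * b).-1 by lia.
  apply: (N1P N) => // [|x j' le_x j'J|j' /slow]; [lia| |lia].
  by have := dominated_iter j'J dom l le_x; lia.
suff [j [jJ fastj]] : exists j, j \in J /\ forall l, h j N + l * b <= h j (N + l * a).
  by exists a, b, N, j.
apply: contrapT => slow.
have [j|L LP] := @eventually_forall K (fun j l => j \in J -> h j (N + l * a) < h j N + l * b).
  have [jJ|] := boolP (j \in J); last by exists 0.
  have /existsNP [l /negP] : ~ forall l, h j N + l * b <= h j (N + l * a).
    by move=> fastj; apply: slow; exists j.
  rewrite -ltnNge => lt_h; exists l => m le_m _.
  (* By domination, a plane once below the line stays below it at all later multiples of a. *)
  have := dominated_iter jJ dom (m - l) (leq_addr (l * a) N).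
  by rewrite -(subnKC le_m) !mulnDl addKn addnA; lia.
by have [j jJ] := fastN L; have := LP L (leqnn L) j jJ; lia.
Qed.

(** * Belts and the top group *)

Definition belt k := exists a b c, [/\ 0 < a, 0 < b &
  forall x, a * h k x <= b * x + c /\ b * x <= a * h k x + c].

(** Up to a constant, a h(x) - b x never increases beyond N. Either it is bounded below, which gives
    a belt, or it tends to minus infinity and the plane falls behind. The plane of [exists_top_line]
    is of the first kind. *)
Lemma exists_top_group j0 : j0 \in J -> exists J' : {set K},
  [/\ J' \subset J, J' != set0, forall j, j \in J' -> belt j &
    forall M, exists N, forall x, N <= x -> forall i j,
      i \in J' -> j \in J -> j \notin J' -> h j x + M <= h i x].
Proof.
move=> j0J; have [a [b [N [j1 [a_gt0 j1J dom fast]]]]] := exists_top_line j0J.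
have divide x y : x <= y -> exists l r, r < a /\ y = x + l * a + r.
  move=> lexy; exists ((y - x) %/ a), ((y - x) %% a).
  by rewrite ltn_pmod // -addnA -divn_eq subnKC.
have later j x y : N <= x -> x <= y -> j \in J -> a * h j y + b * x <= a * h j x + a * b + b * y.
  move=> leN lexy jJ; have jS := subsetP JS j jJ.
  have [l [r [lt_r eqy]]] := divide x y lexy.
  have := dominated_iter jJ dom l.+1 leN.
  have : h j y <= h j (x + l.+1 * a) by apply: height_mono; rewrite // mulSn; lia.
  rewrite mulSn => le1 le2.
  have : a * h j y <= a * (h j x + (b + l * b)) by rewrite leq_mul2l (leq_trans le1 le2) orbT.
  have : b * (x + l * a) <= b * y by rewrite leq_mul2l; lia.
  by nia.
have upper j : j \in J -> forall x, a * h j x <= b * x + (a * h j N + a * b).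
  move=> jJ x; have [le_x|lt_x] := leqP N x; first by have := later j N x (leqnn N) le_x jJ; lia.
  have : a * h j x <= a * h j N by rewrite leq_mul2l height_mono ?(subsetP JS) ?orbT // ltnW.
  lia.
have b_gt0 : 0 < b.
  rewrite lt0n; apply/eqP => b0; have [x xP] := height_unbounded (h j1 N).+1.
  have := upper j1 j1J x; have := xP x (leqnn x) j1 (subsetP JS _ j1J).
  rewrite b0 !mul0n muln0 addn0 add0n leq_mul2l; lia.
pose J' := [set j in J | `[< exists c, forall x, b * x <= a * h j x + c >]].
exists J'; split.
- by apply/subsetP => j; rewrite inE => /andP[].
- apply/set0Pn; exists j1; rewrite inE j1J; apply/asboolP; exists (b * (N + a)) => x.
  have [le_x|lt_x] := leqP N x; last by nia.
  have [l [r [lt_r eqx]]] := divide N x le_x.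
  have : a * (l * b) <= a * h j1 x.
    rewrite leq_mul2l; apply/orP; right; apply: leq_trans (leq_addl _ _) _.
    apply: leq_trans (fast l) _; apply: height_mono (subsetP JS _ j1J) _; lia.
  have : b * x <= b * (N + l * a + a) by rewrite leq_mul2l; lia.
  by nia.
- move=> j; rewrite inE => /andP[jJ /asboolP [c cP]].
  exists a, b, (c + (a * h j N + a * b)); split=> // x.
  by have := cP x; have := upper j jJ x; lia.
move=> M.
have [|n nP] := @eventually_forall (K * K)%type (fun p x => p.1 \in J' -> p.2 \in J ->
    p.2 \notin J' -> h p.2 x + M <= h p.1 x); last first.
  by exists n => x /nP xP i j iJ jJ jNJ'; exact: (xP (i, j)).
move=> [i j] /=; rewrite inE; have [iJ|_] /= := boolP (i \in J); last by exists 0.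
have [[c cP]|nc] := pselect (exists c, forall x, b * x <= a * h i x + c); last first.
  by exists 0 => n _ /asboolP.
have [jJ|jNJ] := boolP (j \in J); last by exists 0.
have [jJ'|jNJ'] := boolP (j \in J'); first by exists 0.
(* At x0 plane j is so low that by [later] it stays M below plane i; the summand b N forces x0
   beyond N. *)
have /existsNP [x0 /negP] : ~ forall x, b * x <= a * h j x + (c + a * M + a * b + b * N).
  by move=> low; move: jNJ'; rewrite inE jJ /= => /asboolP; apply; eexists; exact: low.
rewrite -ltnNge => lt_x0; exists x0 => x le_x _ _ _.
have leNx0 : N <= x0 by rewrite -(leq_pmul2l b_gt0); lia.
have ? := later j x0 x leNx0 le_x jJ; have ? := cP x.
by rewrite -(leq_pmul2l a_gt0) mulnDr; lia.
Qed.

End Lower.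

(** Induction on the size of [J], from all steep pairs, where the gap condition is vacuous; removing
    the top group preserves that condition. *)
Lemma steep_belt k : k \in steep_pairs -> belt k.
Proof.
have [C lip] := height_lipschitz.
suff belt_below n (J : {set K}) : #|J| <= n -> J \subset steep_pairs ->
    (forall M, exists N, forall x, N <= x ->
      forall i j, i \in steep_pairs -> i \notin J -> j \in J -> h j x + M <= h i x) ->
    forall j, j \in J -> belt j.
  apply: (belt_below #|steep_pairs| steep_pairs (leqnn _) (subxx _)) => M.
  by exists 0 => x _ i j ->.
elim: n J => [|n IHn] J leJ JS gap j jJ.
  by move: leJ; rewrite leqn0 cards_eq0 => /eqP J0; rewrite J0 inE in jJ.
have [J' [J'J J'0 beltJ' gapJ']] := exists_top_group lip JS gap jJ.
have [/beltJ' //|jNJ'] := boolP (j \in J').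
apply: (IHn (J :\: J')); last by rewrite inE jNJ'.
- rewrite -ltnS; apply: leq_trans leJ; apply: proper_card.
  have [i iJ'] := set0Pn _ J'0; rewrite properEneq subsetDl andbT.
  by apply: contraTneq (subsetP J'J i iJ') => <-; rewrite inE iJ'.
- by apply: subset_trans JS; exact: subsetDl.
move=> M; have [N1 N1P] := gap M; have [N2 N2P] := gapJ' M.
exists (N1 + N2) => x le_x i j' iS; rewrite !inE negb_and negbK => iJ /andP[j'NJ' j'J].
have [iJ'|iNJ'] := boolP (i \in J'); first by apply: N2P => //; lia.
by apply: N1P => //; [lia | rewrite (negPf iNJ') in iJ].
Qed.

End Colouring.

(** * Simulation as a colouring *)

Section Net.

Variable N : ocn.

Lemma step_effect (s t : config N) a : step s a t -> adjacent s.2 t.2.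
Proof. by rewrite /step /adjacent => /rules_effect; rewrite !inE; lia. Qed.

Lemma step_translate (p q : state N) m n m' n' a : (n'%:Z - m'%:Z = n%:Z - m%:Z)%R ->
  step (p, m) a (q, n) -> step (p, m') a (q, n').
Proof. by rewrite /step /= => ->. Qed.

Lemma simulated_step (s t : config N) a s' : simulated s t -> step s a s' ->
  exists2 t', step t a t' & simulated s' t'.
Proof.
move=> [R simR Rst] /(simR _ _ Rst) [t' tt' Rs't'].
by exists t' => //; exists R.
Qed.

Lemma simulated_mono_r (q : state N) n n' (s : config N) :
  n <= n' -> simulated s (q, n) -> simulated s (q, n').
Proof.
move=> len [R simR Rsn].
exists (fun s t => exists2 d, d <= t.2 & R s (t.1, t.2 - d)); last first.
  by exists (n' - n) => /=; [lia | rewrite subKn].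
move=> {n n' len Rsn} {}s [{}q n] [d /= led Rs] a s' ss'.
have [[q' n'] tt' Rs'] := simR _ _ Rs _ _ ss'.
exists (q', n' + d); first by apply: step_translate tt'; lia.
by exists d => /=; rewrite ?leq_addl ?addnK.
Qed.

Definition simulated_at (pq : state N * state N) x y := simulated (pq.1, y) (pq.2, x).

Lemma simulated_at_mono pq x x' y y' :
  x <= x' -> y' <= y -> simulated_at pq x y -> simulated_at pq x' y'.
Proof. by move=> lex ley /(simulated_mono_r lex); exact: simulatedW. Qed.

(** Adding the white points of violations in [V] to [simulated] gives a simulation: the answer at
    the black translate, copied back, leads to a simulated pair or to a neighbouring violation. So
    these points would be black. *)
Lemma simulated_violation_travels a1 b1 a2 b2 V :
  (forall k x y, V k x y -> violation simulated_at a1 b1 a2 b2 k x y ->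
     [/\ 0 < x, 0 < y &
       forall k' x' y', adjacent x x' -> adjacent y y' ->
         violation simulated_at a1 b1 a2 b2 k' x' y' -> V k' x' y']) ->
  forall k x y, V k x y -> ~ violation simulated_at a1 b1 a2 b2 k x y.
Proof.
move=> Vclosed k x y Vkxy viol; apply: (proj2 viol).
pose R (s t : config N) := simulated s t \/ exists x y, [/\ t.2 = x + a1, s.2 = y + b1,
  V (s.1, t.1) x y & violation simulated_at a1 b1 a2 b2 (s.1, t.1) x y].
exists R; last by right; exists x, y; rewrite -!surjective_pairing.
move=> {k x y Vkxy viol} [p m] [q n] [simst|[x [y /= [-> -> Vxy viol]]]] a s' ss'.
  by have [t' tt' sim'] := simulated_step simst ss'; exists t' => //; left.
have [x_gt0 y_gt0 next] := Vclosed _ _ _ Vxy viol.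
case: s' ss' => p' m' ss'; have /= [mm' m'm] := step_effect ss'.
(* Here y > 0 is used: a step lowers the counter by at most 1, so [m'] is at least [b1]. *)
have [y' m'E] : exists y', m' = y' + b1 by exists (m' - b1); lia.
rewrite {m'}m'E in ss' mm' m'm *.
have ss2 : step (p, y + b2) a (p', y' + b2) by apply: step_translate ss'; lia.
have [[q' n'] tt' sim'] := simulated_step (proj1 viol) ss2.
have /= [nn' n'n] := step_effect tt'.
have [x' n'E] : exists x', n' = x' + a2 by exists (n' - a2); lia.
rewrite {n'}n'E in tt' sim' nn' n'n *.
exists (q', x' + a1); first by apply: step_translate tt'; lia.
have [sim1|nsim1] := pselect (simulated (p', y' + b1) (q', x' + a1)); first by left.
by right; exists x', y'; split=> //; apply: next => //; rewrite /adjacent; lia.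
Qed.

Lemma frontier_height (p q : state N) n : steep simulated_at (p, q) ->
  frontier p q n = ((height simulated_at (p, q) n)%:R - 1)%:E%R.
Proof.
move=> pqS; have pqS' : (p, q) \in steep_pairs simulated_at by rewrite inE; apply/asboolP.
have hP y : simulated_at (p, q) n y <-> y < height simulated_at (p, q) n.
  exact: (heightP simulated_at_mono).
have fin : ~ forall m, simulated_counters p q n m by have [/(_ n) [y ny] _] := pqS => /(_ y).
have [A0|nA0] := EM (simulated_counters p q n 0).
  have [m -> [Am maxm]] := frontier_maxP fin A0.
  have lt_m := proj1 (hP m) Am; have := maxm (height simulated_at (p, q) n).-1.
  move=> /(_ (proj2 (hP _) _)) max'; have -> : height simulated_at (p, q) n = m.+1 by lia.
  by rewrite -natr1 addrK.
rewrite /frontier; case: asboolP => [/fin //|_]; case: asboolP => // _.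
suff -> : height simulated_at (p, q) n = 0 by rewrite sub0r.
by apply/eqP; rewrite -leqn0 leqNgt; apply/negP => /hP.
Qed.

Lemma steep_pair (p q : state N) : (forall n, frontier p q n <> +oo%E) ->
  ~ (exists c : nat, forall n, (frontier p q n < c%:R%:E)%E) ->
  steep simulated_at (p, q).
Proof.
move=> fin unb; split=> [x|c].
  apply: contrapT => inf; apply: (fin x); rewrite /frontier; case: asboolP => // -[] m.
  by apply: contrapT => nm; apply: inf; exists m.
apply: contrapT => bnd; apply: unb; exists c => n; rewrite /frontier.
case: asboolP => [all|nall]; first by case: bnd; exists n; apply: all.
have [A0|nA0] := EM (simulated_counters p q n 0); last first.
  by case: asboolP => // _; rewrite lte_fin (lt_le_trans (ltrN10 _)).
have [m + [Am _]] := frontier_maxP nall A0.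
rewrite /frontier; case: asboolP => // _ ->; rewrite lte_fin ltr_nat ltnNge.
by apply/negP => lecm; apply: bnd; exists n; exact: simulatedW Am.
Qed.

End Net.

Local Open Scope ring_scope.

Theorem theorem4 (N : ocn) (p q : state N)
  (f_finite : forall n : nat, frontier p q n <> +oo%E)
  (f_unbounded :
     ~ exists c : nat, forall n : nat, (frontier p q n < c%:R%:E)%E) :
  exists (alpha : rat) (c : nat),
    0 < alpha /\
    forall n : nat,
      (`|frontier p q n - (alpha * n%:R)%:E| <= c%:R%:E)%E.
Proof.
have pqS := steep_pair f_finite f_unbounded.
have [|a [b [c [a_gt0 b_gt0 beltP]]]] :=
  steep_belt (@simulated_at_mono N) (@simulated_violation_travels N) (k := (p, q)).
  by rewrite inE; apply/asboolP.
(* The extra 1 absorbs the shift between height and frontier; c survives the division by a, as a is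
   at least 1. *)
exists (b%:R / a%:R), c.+1; split=> [|n]; first by rewrite divr_gt0 ?ltr0n.
rewrite frontier_height // lee_fin; set h := height _ _ _.
have [] := beltP n; rewrite -/h -!(ler_nat rat) !natrD !natrM => up low.
have a_ge1 : 1 <= a%:R :> rat by rewrite ler1n.
have -> : h%:R - 1 - b%:R / a%:R * n%:R = (a%:R * h%:R - b%:R * n%:R) / a%:R - 1 :> rat.
  by field; rewrite pnatr_eq0 -lt0n.
have : `|(a%:R * h%:R - b%:R * n%:R) / a%:R| <= c%:R :> rat.
  rewrite normrM normfV normr_nat ler_pdivrMr ?ltr0n //.
  apply: le_trans (_ : c%:R <= _); first by rewrite ler_norml; lra.
  by rewrite ler_peMr.
by rewrite -natr1; move: (_ / _) => z; rewrite !ler_norml; lra.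
Qed.
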